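(* Let $X$ be a set, let $\delta_1\prec\delta_2\prec\cdots$ be a strictly increasing sequence in the join semilattice $M(X)$ of coarse equivalence classes of uniformly discrete metrics on $X$, and let $\mathcal E_{\delta_n}$ be the corresponding coarse structures. Let $\mathcal E=\bigcup_{n\in\mathbb N}\mathcal E_{\delta_n}$ be the coarse structure generated by all $\mathcal E_{\delta_n}$. Let $F_1\in I(M(X))$ be the ideal of all equivalence classes of metrics dominated by $\mathcal E$, and let $F_2=\bigcup_{n\in\mathbb N}F_{\delta_n}\in I(M(X))$, where $F_{\delta_n}=\{\beta\in M(X):\beta\preceq\delta_n\}$. Then $F_1\ne F_2$, but $\Phi(F_1)=\Phi(F_2)$, where $\Phi(F)$ denotes the coarse structure generated by all $\mathcal E_d$ with $[d]\in F$.
   Context: Two metrics $d_1,d_2$ on $X$ are coarsely equivalent, $d_1\sim d_2$, if there is a monotone function $\varphi:[0,\infty)\to[0,\infty)$ with $\lim_{t\to\infty}\varphi(t)=\infty$ such that $d_1(x,y)\le\varphi(d_2(x,y))$ and $d_2(x,y)\le\varphi(d_1(x,y))$ for all $x,y\in X$. A metric $d$ is uniformly discrete if there is $r>0$ with $d(x,y)\ge r$ for all $x\ne y$. $\mathcal M(X)$ is the set of uniformly discrete metrics on $X$, $M(X)=\mathcal M(X)/\sim$, and $[a]$ is the class of $a$. For $a,b\in\mathcal M(X)$, $(a\lor b)(x,y)=\inf\sum_{i=1}^n\min(a(x_{i-1},x_i),b(x_{i-1},x_i))$, the infimum being over all finite sequences $x=x_0,x_1,\ldots,x_n=y$ in $X$.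 The join on $M(X)$ is $[a]\lor[b]=[a\lor b]$, and $\alpha\preceq\beta$ in $M(X)$ means $\alpha\lor\beta=\beta$; equivalently, $[a]\preceq[b]$ iff there is a homeomorphism $\varphi$ of $[0,\infty)$ with $b(x,y)\le\varphi(a(x,y))$ for all $x,y\in X$. $\alpha\prec\beta$ means $\alpha\preceq\beta$ and $\alpha\neq\beta$. $I(M(X))$ is the set of ideals of $M(X)$, i.e. of subsets $F\subset M(X)$ that are downwards closed ($\alpha\preceq\beta$, $\beta\in F$ imply $\alpha\in F$) and closed under joins ($\alpha,\beta\in F$ implies $\alpha\lor\beta\in F$). A coarse structure on $X$ is a family $\mathcal E$ of subsets of $X\times X$ containing the diagonal and closed under taking subsets, finite unions, inverses $E^{-1}=\{(y,x):(x,y)\in E\}$, and finite compositions $E\circ G=\{(x,z):(x,y)\in E,\ (y,z)\in G\text{ for some }y\in X\}$. For a metric $d$, put $E_R(d)=\{(x,y)\in X\times X:d(x,y)\le R\}$; $\mathcal E_d$ is the coarse structure consisting of all $E\subset X\times X$ with $E\subset E_R(d)$ for some $R>0$. It depends only on $\alpha=[d]$ and is also denoted $\mathcal E_\alpha$. A metric $d$ is dominated by a coarse structure $\mathcal E$ if $E_R(d)\in\mathcal E$ for every $R>0$; this depends only on $[d]$. *)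

(* Defs.v *)
From HB Require Import structures.
From mathcomp Require Import all_boot all_order all_algebra.
From mathcomp Require Import generic_quotient.
From mathcomp Require Import all_classical all_reals all_analysis.

Set Implicit Arguments.
Unset Strict Implicit.
Unset Printing Implicit Defensive.
Import Order.TTheory GRing.Theory Num.Theory.
Import numFieldNormedType.Exports.
Local Open Scope classical_set_scope.
Local Open Scope ring_scope.
Local Open Scope quotient_scope.

Record udMetric (R : realType) (X : Type) := UdMetric {
  dist :> X -> X -> R;
  dist_ge0 : forall x y, 0 <= dist x y;
  dist_eq0 : forall x y, dist x y = 0 <-> x = y;
  distC : forall x y, dist x y = dist y x;
  dist_triangle : forall x y z, dist x z <= dist x y + dist y z;
  dist_discrete : exists2 r : R, 0 < r & forall x y, x <> y -> r <= dist x y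
}.

HB.instance Definition _ (R : realType) (X : Type) :=
  gen_eqMixin (udMetric R X).
HB.instance Definition _ (R : realType) (X : Type) :=
  gen_choiceMixin (udMetric R X).

Section UdMetricTheory.
Variables (R : realType) (X : Type).
Implicit Types a b c d : udMetric R X.

Lemma dist_xx d x : d x x = 0. Proof. exact/dist_eq0. Qed.

Lemma udMetricP a b : (forall x y, a x y = b x y) -> a = b.
Proof.
case: a b => [a a1 a2 a3 a4 a5] [b b1 b2 b3 b4 b5] /= eqab.
have {}eqab : a = b by apply/funext => x; apply/funext => y.
by subst b; congr UdMetric; apply: Prop_irrelevance.
Qed.

(* phi is a total function R -> R of which only the restriction to [0, +oo[   *)
(* is constrained.                                                            *)
Definition coarsely_equivalent a b : Prop :=
  exists phi : R -> R,
    [/\ forall t : R, 0 <= t -> 0 <= phi t,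
        forall s t : R, 0 <= s -> s <= t -> phi s <= phi t,
        phi t @[t --> +oo] --> +oo,
        forall x y, a x y <= phi (b x y) &
        forall x y, b x y <= phi (a x y)].

Lemma coarsely_equivalent_refl a : coarsely_equivalent a a.
Proof. by exists id; split => //; exact: cvg_id. Qed.

Lemma coarsely_equivalent_sym a b :
  coarsely_equivalent a b -> coarsely_equivalent b a.
Proof. by move=> [phi [? ? ? ? ?]]; exists phi. Qed.

Lemma coarsely_equivalentP a b :
  (exists phi psi : R -> R,
    [/\ forall t : R, 0 <= t -> 0 <= phi t,
        forall s t : R, 0 <= s -> s <= t -> phi s <= phi t,
        forall s t : R, 0 <= s -> s <= t -> psi s <= psi t,
        forall x y, a x y <= phi (b x y) &
        forall x y, b x y <= psi (a x y)]) ->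
  coarsely_equivalent a b.
Proof.
move=> [phi [psi [phi0 phiM psiM ab ba]]].
exists (fun t => Num.max (phi t) (psi t) + `|t|); split.
- by move=> t t0; rewrite addr_ge0// le_max phi0.
- move=> s t s0 st; rewrite lerD//; last first.
    by rewrite !ger0_norm// (le_trans s0).
  by rewrite ge_max !le_max phiM//= psiM// orbT.
- apply/cvgryPge => A; near=> t.
  have t0 : 0 <= t.
    near: t; exists 0; split; first exact: num_real.
    by move=> y /ltW y0; exact y0.
  have At : A <= t.
    near: t; exists A; split; first exact: num_real.
    by move=> y /ltW.
  rewrite (le_trans At)//.
  by rewrite (ger0_norm t0) lerDr le_max phi0.
- by move=> x y; rewrite (le_trans (ab x y))// -[leLHS]addr0 lerD// le_max lexx.
- move=> x y; rewrite (le_trans (ba x y))// -[leLHS]addr0 lerD//.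
  by rewrite le_max lexx orbT.
Unshelve. all: by end_near. Qed.

Lemma coarsely_equivalent_trans a b c :
  coarsely_equivalent a b -> coarsely_equivalent b c -> coarsely_equivalent a c.
Proof.
move=> [f [f0 fM _ ab ba]] [g [g0 gM _ bc cb]]; apply: coarsely_equivalentP.
exists (f \o g), (g \o f); split => /=.
- by move=> t t0; exact/f0/g0.
- by move=> s t s0 st; rewrite fM// ?g0// gM.
- by move=> s t s0 st; rewrite gM// ?f0// fM.
- by move=> x y; rewrite (le_trans (ab x y))// fM// dist_ge0.
- by move=> x y; rewrite (le_trans (cb x y))// gM// dist_ge0.
Qed.

Definition coarse_eqb a b : bool := `[< coarsely_equivalent a b >].

Lemma coarse_eqb_refl : reflexive coarse_eqb.
Proof. by move=> a; exact/asboolP/coarsely_equivalent_refl. Qed.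

Lemma coarse_eqb_sym : symmetric coarse_eqb.
Proof.
by move=> a b; apply/asboolP/asboolP; exact: coarsely_equivalent_sym.
Qed.

Lemma coarse_eqb_trans : transitive coarse_eqb.
Proof.
move=> b a c /asboolP ab /asboolP bc.
exact/asboolP/(coarsely_equivalent_trans ab bc).
Qed.

Canonical coarse_equiv_rel :=
  EquivRel coarse_eqb coarse_eqb_refl coarse_eqb_sym coarse_eqb_trans.

(* The chains x = u 0, u 1, ..., u n = y are encoded by functions nat -> X.   *)
Definition chain_sums a b x y : set R :=
  [set s | exists (n : nat) (u : nat -> X),
    [/\ u 0%N = x, u n = y &
        s = \sum_(i < n) Num.min (a (u i) (u i.+1)) (b (u i) (u i.+1))]].

Definition join_dist a b x y : R := inf (chain_sums a b x y).

Let mind a b x y := Num.min (a x y) (b x y).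

Let mind_ge0 a b x y : 0 <= mind a b x y.
Proof. by rewrite le_min !dist_ge0. Qed.

Lemma chain_sums1 a b x y : chain_sums a b x y (mind a b x y).
Proof.
by exists 1%N, (fun i => if i == 0%N then x else y); rewrite big_ord1.
Qed.

Lemma chain_sums_neq0 a b x y : chain_sums a b x y !=set0.
Proof. by exists (mind a b x y); exact: chain_sums1. Qed.

Lemma chain_sums_ge0 a b x y : lbound (chain_sums a b x y) 0.
Proof. by move=> _ [n [u [_ _ ->]]]; apply: sumr_ge0 => i _; exact: mind_ge0. Qed.

Lemma chain_sums_has_inf a b x y : has_inf (chain_sums a b x y).
Proof.
by split; [exact: chain_sums_neq0 | exists 0; exact: chain_sums_ge0].
Qed.

Lemma chain_sumsC a b x y : chain_sums a b x y `<=` chain_sums a b y x.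
Proof.
move=> _ [n [u [ux uy ->]]]; exists n, (fun i => u (n - i)%N).
rewrite subn0 subnn; split => //.
rewrite (reindex_inj rev_ord_inj)/=; apply: eq_bigr => i _.
rewrite subnS prednK ?subn_gt0//.
by rewrite distC (distC b).
Qed.

Lemma chain_sumsD a b x y z s t :
  chain_sums a b x y s -> chain_sums a b y z t -> chain_sums a b x z (s + t).
Proof.
move=> [n [u [ux uy ->]]] [m [v [vy vz ->]]].
exists (n + m)%N, (fun i => if (i <= n)%N then u i else v (i - n)%N).
split => //.
  case: leqP => [|_]; last by rewrite addnC addnK.
  rewrite -{2}(addn0 n) leq_add2l leqn0 => /eqP m0.
  by rewrite m0 addn0 uy -vy -vz m0.
rewrite big_split_ord/=; congr (_ + _); apply: eq_bigr => i _.
  by rewrite (ltnW (ltn_ord i)) (ltn_ord i).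
rewrite ltnNge leq_addr/= -addnS [(n + i.+1)%N]addnC addnK.
case: leqP => [|_]; last by rewrite addnC addnK.
rewrite -{2}(addn0 n) leq_add2l leqn0 => /eqP->.
by rewrite addn0 uy -vy.
Qed.

Lemma join_dist_ge0 a b x y : 0 <= join_dist a b x y.
Proof.
apply: lb_le_inf; [exact: chain_sums_neq0 | exact: chain_sums_ge0].
Qed.

Lemma join_dist_le a b x y s : chain_sums a b x y s -> join_dist a b x y <= s.
Proof. by apply: ge_inf; exists 0; exact: chain_sums_ge0. Qed.

Lemma join_dist_lel a b x y : join_dist a b x y <= a x y.
Proof.
by rewrite (le_trans (join_dist_le (chain_sums1 a b x y)))// ge_min lexx.
Qed.

Lemma join_dist_ler a b x y : join_dist a b x y <= b x y.
Proof.
by rewrite (le_trans (join_dist_le (chain_sums1 a b x y)))// ge_min lexx orbT.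
Qed.

(* The join is the greatest pseudometric below both a and b.                  *)
Lemma join_dist_max a b (d : X -> X -> R) :
  (forall x, d x x <= 0) -> (forall x y z, d x z <= d x y + d y z) ->
  (forall x y, d x y <= a x y) -> (forall x y, d x y <= b x y) ->
  forall x y, d x y <= join_dist a b x y.
Proof.
move=> d0 dD da db x y; apply: lb_le_inf; first exact: chain_sums_neq0.
move=> _ [n [u [<- <- ->]]]; elim: n => [|n IHn]; first by rewrite big_ord0.
rewrite big_ord_recr/= (le_trans (dD _ (u n) _))// lerD//.
by rewrite le_min da db.
Qed.

Lemma mind_discrete a b :
  exists2 r : R, 0 < r & forall x y, x <> y -> r <= mind a b x y.
Proof.
have [r r0 ra] := dist_discrete a; have [s s0 sb] := dist_discrete b.
exists (Num.min r s); first by rewrite lt_min r0.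
by move=> x y xy; rewrite /mind le_min !ge_min ra// sb// orbT.
Qed.

Lemma join_dist_discrete a b :
  exists2 r : R, 0 < r & forall x y, x <> y -> r <= join_dist a b x y.
Proof.
have [r r0 rab] := mind_discrete a b; exists r => // x y xy.
apply: lb_le_inf; first exact: chain_sums_neq0.
move=> _ [n [u [ux uy ->]]]; move: xy; rewrite -ux -uy.
elim: n {uy} => // n IHn xy; rewrite big_ord_recr/=.
have [uE|uNE] := pselect (u 0%N = u n).
  by rewrite uE in xy; rewrite -[leLHS]add0r lerD ?rab ?sumr_ge0// => i _;
    exact: mind_ge0.
by rewrite -[leLHS]addr0 lerD ?IHn//; exact: mind_ge0.
Qed.

Lemma join_dist_eq0 a b x y : join_dist a b x y = 0 <-> x = y.
Proof.
split=> [d0|->]; last first.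
  by apply/eqP; rewrite eq_le join_dist_ge0 -(dist_xx a y) join_dist_lel.
have [r r0 rab] := join_dist_discrete a b.
by apply: contrapT => /rab; rewrite d0 leNgt r0.
Qed.

Lemma join_distC a b x y : join_dist a b x y = join_dist a b y x.
Proof.
by congr inf; apply/seteqP; split; exact: chain_sumsC.
Qed.

Lemma join_dist_triangle a b x y z :
  join_dist a b x z <= join_dist a b x y + join_dist a b y z.
Proof.
apply/ler_addgt0Pr => e e0.
have e20 : 0 < e / 2 by rewrite divr_gt0.
have [s sxy slt] := inf_adherent e20 (chain_sums_has_inf a b x y).
have [t tyz tlt] := inf_adherent e20 (chain_sums_has_inf a b y z).
rewrite (le_trans (join_dist_le (chain_sumsD sxy tyz)))//.
by rewrite [e in leRHS]splitr addrACA lerD// ltW.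
Qed.

Definition joinM a b : udMetric R X :=
  UdMetric (join_dist_ge0 a b) (join_dist_eq0 a b) (join_distC a b)
           (join_dist_triangle a b) (join_dist_discrete a b).

Lemma joinM_max a b d : (forall x y, d x y <= a x y) ->
  (forall x y, d x y <= b x y) -> forall x y, d x y <= joinM a b x y.
Proof.
apply: join_dist_max => [x|x y z]; first by rewrite dist_xx.
exact: dist_triangle.
Qed.

Lemma udMetric_anti a b : (forall x y, a x y <= b x y) ->
  (forall x y, b x y <= a x y) -> a = b.
Proof.
by move=> ab ba; apply: udMetricP => x y; apply/eqP; rewrite eq_le ab ba.
Qed.

Lemma joinMC : commutative joinM.
Proof.
by move=> a b; apply: udMetric_anti; apply: joinM_max => x y;
  rewrite ?join_dist_lel ?join_dist_ler.
Qed.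

Lemma joinMA : associative joinM.
Proof.
have l a b x y : joinM a b x y <= a x y by exact: join_dist_lel.
have r a b x y : joinM a b x y <= b x y by exact: join_dist_ler.
move=> a b c; apply: udMetric_anti; apply: joinM_max.
- apply: joinM_max => // x y.
  by rewrite (le_trans (r a (joinM b c) x y)).
- by move=> x y; rewrite (le_trans (r a (joinM b c) x y)).
- by move=> x y; rewrite (le_trans (l (joinM a b) c x y)).
- apply: joinM_max => // x y.
  by rewrite (le_trans (l (joinM a b) c x y)).
Qed.

Lemma joinMM : idempotent_op joinM.
Proof.
move=> a; apply: udMetric_anti; last exact: joinM_max.
by move=> x y; exact: join_dist_lel.
Qed.

Lemma joinM_ub a b a' b' (f g : R -> R) :
  (forall t : R, 0 <= t -> 0 <= f t) -> (forall t : R, 0 <= t -> 0 <= g t) ->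
  (forall s t : R, 0 <= s -> s <= t -> f s <= f t) ->
  (forall s t : R, 0 <= s -> s <= t -> g s <= g t) ->
  (forall x y, a x y <= f (a' x y)) -> (forall x y, b x y <= g (b' x y)) ->
  exists h : R -> R,
    [/\ forall t : R, 0 <= t -> 0 <= h t,
        forall s t : R, 0 <= s -> s <= t -> h s <= h t &
        forall x y, joinM a b x y <= h (joinM a' b' x y)].
Proof.
move=> f0 g0 fM gM fa gb.
have [r r0 rab] := mind_discrete a' b'.
pose k t := f t + g t; pose h t := (t + 1) / r * k (t + 1).
have k0 t : 0 <= t -> 0 <= k t by move=> t0; rewrite addr_ge0 ?f0 ?g0.
have kM s t : 0 <= s -> s <= t -> k s <= k t.
  by move=> s0 st; rewrite lerD ?fM ?gM.
have mk x y : mind a b x y <= k (mind a' b' x y).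
  rewrite /mind /k; case: (leP (a' x y) (b' x y)) => _.
    by rewrite ge_min (le_trans (fa x y))// lerDl g0// dist_ge0.
  by rewrite ge_min (le_trans (gb x y)) ?orbT// lerDr f0// dist_ge0.
have step S x y : mind a' b' x y <= S ->
    mind a b x y <= mind a' b' x y / r * k S.
  move=> mS; have S0 : 0 <= S by rewrite (le_trans _ mS).
  have [->|xy] := pselect (x = y).
    by rewrite /mind !dist_xx minxx !mul0r.
  rewrite (le_trans (mk _ _))// (le_trans (kM _ _ (mind_ge0 _ _ _ _) mS))//.
  by rewrite ler_peMl ?k0// ler_pdivlMr// mul1r rab.
exists h; split.
- by move=> t t0; rewrite mulr_ge0 ?divr_ge0 ?k0 ?addr_ge0// ltW.
- move=> s t s0 st.
  have s10 : 0 <= s + 1 by rewrite addr_ge0.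
  rewrite ler_pM ?divr_ge0 ?k0 ?(ltW r0)//; last by rewrite kM// lerD2r.
  by rewrite ler_pM2r ?invr_gt0// lerD2r.
move=> x y.
have [s xys slt] := inf_adherent ltr01 (chain_sums_has_inf a' b' x y).
have s0 := chain_sums_ge0 xys.
apply: (@le_trans _ _ (s / r * k s)); last first.
  rewrite /h ler_pM ?divr_ge0 ?k0 ?(ltW r0)//.
    by rewrite ler_pM2r ?invr_gt0// ltW.
  by rewrite kM// ltW.
have [n [u [ux uy sE]]] := xys.
apply: (@le_trans _ _ (\sum_(i < n) mind a b (u i) (u i.+1))).
  by apply: join_dist_le; exists n, u.
rewrite {1}sE !mulr_suml; apply: ler_sum => i _; apply: step.
rewrite sE (bigD1 i)//= lerDl sumr_ge0// => j _; exact: mind_ge0.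
Qed.

Lemma joinM_equiv a b a' b' :
  coarsely_equivalent a a' -> coarsely_equivalent b b' ->
  coarsely_equivalent (joinM a b) (joinM a' b').
Proof.
move=> [f [f0 fM _ fa fa']] [g [g0 gM _ gb gb']]; apply: coarsely_equivalentP.
have [h [h0 hM hab]] := joinM_ub f0 g0 fM gM fa gb.
have [h' [_ h'M h'ab]] := joinM_ub f0 g0 fM gM fa' gb'.
by exists h, h'; split.
Qed.

End UdMetricTheory.

Definition metricClass (R : realType) (X : Type) :=
  {eq_quot (@coarse_equiv_rel R X)}.

HB.instance Definition _ (R : realType) (X : Type) :=
  Choice.on (metricClass R X).
HB.instance Definition _ (R : realType) (X : Type) :=
  EqQuotient.on (metricClass R X).

Fact metricClass_display : Order.disp_t. Proof. exact: Order.Disp tt tt. Qed.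

Section MetricClassOrder.
Variables (R : realType) (X : Type).
Implicit Types a b d : udMetric R X.
Implicit Types al be : metricClass R X.

Definition mclass d : metricClass R X := \pi_(metricClass R X) d.

Lemma mclassP a b : mclass a = mclass b <-> coarsely_equivalent a b.
Proof.
by split=> [/eqmodP/asboolP|ab]//; apply/eqmodP/asboolP.
Qed.

Lemma mclass_surj al : exists d, al = mclass d.
Proof. by exists (repr al); rewrite /mclass reprK. Qed.

Definition join_class al be : metricClass R X :=
  mclass (joinM (repr al) (repr be)).

Lemma join_classE a b : join_class (mclass a) (mclass b) = mclass (joinM a b).
Proof.
by apply/mclassP/joinM_equiv; apply/mclassP; rewrite /mclass reprK.
Qed.

Lemma join_classC : commutative join_class.
Proof.
move=> al be; have [a ->] := mclass_surj al; have [b ->] := mclass_surj be.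
by rewrite !join_classE joinMC.
Qed.

Lemma join_classA : associative join_class.
Proof.
move=> al be ga; have [a ->] := mclass_surj al; have [b ->] := mclass_surj be.
by have [c ->] := mclass_surj ga; rewrite !join_classE joinMA.
Qed.

Lemma join_classxx : idempotent_op join_class.
Proof.
by move=> al; have [a ->] := mclass_surj al; rewrite !join_classE joinMM.
Qed.

Definition le_class al be : bool := join_class al be == be.

Lemma le_class_refl : reflexive le_class.
Proof. by move=> al; apply/eqP; exact: join_classxx. Qed.

Lemma le_class_anti : antisymmetric le_class.
Proof. by move=> al be /andP[/eqP albe /eqP beal]; rewrite -albe join_classC. Qed.

Lemma le_class_trans : transitive le_class.
Proof.
by move=> be al ga /eqP albe /eqP bega; apply/eqP;
  rewrite -bega join_classA albe.
Qed.

HB.instance Definition _ := Order.Le_isPOrder.Build metricClass_display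
  (metricClass R X) le_class_refl le_class_anti le_class_trans.

Lemma le_classEjoin al be : (be <= al)%O = (join_class al be == al).
Proof. by rewrite join_classC. Qed.

HB.instance Definition _ := Order.POrder_Join_isSemilattice.Build
  metricClass_display (metricClass R X)
  join_classC join_classA le_classEjoin.

Definition is_ideal (F : set (metricClass R X)) : Prop :=
  (forall al be, (al <= be)%O -> F be -> F al) /\
  (forall al be, F al -> F be -> F (al `|` be)%O).

Definition principal_ideal al : set (metricClass R X) :=
  [set be | (be <= al)%O].

End MetricClassOrder.

Section CoarseStructures.
Variables (R : realType) (X : Type).
Implicit Types d : udMetric R X.
Implicit Types EE : set (set (X * X)).

Definition is_coarse EE : Prop :=
  [/\ EE diagonal,
      forall A B, A `<=` B -> EE B -> EE A,
      forall A B, EE A -> EE B -> EE (A `|` B),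
      forall A, EE A -> EE (A^-1)%relation &
      forall A B, EE A -> EE B -> EE (A \; B)%relation].

Definition coarse_generated (GG : set (set (X * X))) : set (set (X * X)) :=
  smallest is_coarse GG.

Definition entourage_le d (r : R) : set (X * X) := [set p | d p.1 p.2 <= r].

Definition metric_coarse d : set (set (X * X)) :=
  [set A | exists2 r : R, 0 < r & A `<=` entourage_le d r].

Lemma metric_coarse_equiv d d' : coarsely_equivalent d d' ->
  metric_coarse d = metric_coarse d'.
Proof.
wlog suff: d d' / coarsely_equivalent d d' ->
    metric_coarse d `<=` metric_coarse d'.
  move=> H dd'; apply/seteqP; split; apply: H => //.
  exact: coarsely_equivalent_sym.
move=> [f [f0 fM _ _ d'd]] A [r r0 Ar]; exists (f r + 1).
  by rewrite ltr_wpDl ?f0 ?ltW.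
move=> p /Ar pr; rewrite /entourage_le/= (le_trans (d'd _ _))//.
by rewrite (le_trans (fM _ _ (dist_ge0 _ _ _) pr))// lerDl.
Qed.

Definition class_coarse (al : metricClass R X) : set (set (X * X)) :=
  metric_coarse (repr al).

Lemma class_coarseE d : class_coarse (mclass d) = metric_coarse d.
Proof. by apply/metric_coarse_equiv/mclassP; rewrite /mclass reprK. Qed.

Definition dominated d EE : Prop := forall r, 0 < r -> EE (entourage_le d r).

Definition ideal_coarse (F : set (metricClass R X)) : set (set (X * X)) :=
  coarse_generated
    (\bigcup_(d in [set d | F (mclass d)]) metric_coarse d).

End CoarseStructures.

(* Main.v *)
Require Import Defs.
From mathcomp Require Import all_boot all_order all_algebra.
From mathcomp Require Import all_classical all_reals all_analysis.

Import Order.TTheory GRing.Theory Num.Theory.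

Local Open Scope classical_set_scope.
Local Open Scope ring_scope.

(** The union [EE] of the coarse structures of a strictly increasing sequence of
    classes is again the coarse structure of a single uniformly discrete metric.
    Represent the classes by pointwise decreasing metrics [d 0 >= d 1 >= ...],
    replacing each representative by its join with the previous ones, and put
      [l x y = sup_n min (d n x y) n].
    Each [min (d n) n] is a pseudometric, hence so is their supremum, which is
    finite because [l <= d 0]; the term [n = 1] makes it uniformly discrete.
    Since [l <= d n + n], every [d n]-entourage is an [l]-entourage; and if
    [l x y <= r < n] then the term [n] of the supremum gives [d n x y <= r], so
    every [l]-entourage is a [d n]-entourage for some [n]
    ([metric_coarse_limitM]).

    The order of classes is inclusion of coarse structures
    ([le_mclassP]), so a metric is dominated by [EE] exactly when its class is
    below that of [l]: the ideal [F1] is the principal ideal of [mclass l].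
    Were it equal to [F2], the class of [l] would lie below some [delta n],
    hence [delta n.+1] would too, against strict monotonicity. On the other
    hand the metrics with class in [F1], like those with class in [F2], have
    coarse structures whose union is [EE] itself, so that both ideals generate
    the same coarse structure. *)

(** * The order of classes as inclusion of coarse structures *)

Section CoarseOrder.
Context {R : realType} {X : Type}.
Implicit Types (a b d : udMetric R X) (al : metricClass R X).

Lemma is_coarse_metric_coarse d : is_coarse (metric_coarse d).
Proof.
split.
- exists 1; first exact: ltr01.
  by move=> [x y]; rewrite /diagonal/= => ->; rewrite /entourage_le/= dist_xx ler01.
- by move=> A B AB [r r0 Br]; exists r => //; exact: subset_trans Br.
- move=> A B [r r0 Ar] [s s0 Bs]; exists (r + s); first exact: addr_gt0.
  move=> p [/Ar|/Bs] /le_trans; apply.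
    by rewrite lerDl ltW.
  by rewrite lerDr ltW.
- move=> A [r r0 Ar]; exists r => // -[x y] yx.
  by have := Ar (y, x) yx; rewrite /entourage_le/= distC.
- move=> A B [r r0 Ar] [s s0 Bs]; exists (r + s); first exact: addr_gt0.
  move=> [x z] [y Bxy Ayz]; rewrite /entourage_le/= addrC.
  apply: le_trans (dist_triangle d x y z) _.
  by apply: lerD; [exact: (Bs (x, y) Bxy) | exact: (Ar (y, z) Ayz)].
Qed.

Lemma dominated_metric_coarse a b :
  dominated a (metric_coarse b) <-> metric_coarse a `<=` metric_coarse b.
Proof.
split=> [ab A [r r0 Ar]|ab r r0].
  by have [s s0 rs] := ab r r0; exists s => //; exact: subset_trans rs.
by apply: ab; exists r.
Qed.

(** For the converse, the modulus of [b] against [a] is the supremum of [b] over the entourages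
    of [a]; it is turned into a modulus of [b] against [joinM a b] by comparing
    the latter with [joinM b b = b]. *)
Lemma le_mclassP a b :
  (mclass a <= mclass b)%O <-> metric_coarse a `<=` metric_coarse b.
Proof.
have -> : (mclass a <= mclass b)%O = (mclass (joinM a b) == mclass b).
  by rewrite -join_classE.
split=> [/eqP/mclassP/metric_coarse_equiv <- A [r r0 Ar]|ab].
  exists r => // p /Ar; apply: le_trans; exact: join_dist_lel.
(* The element 0 keeps the supremum meaningful when [X] is empty. *)
pose S (t : R) := [set s | s = 0 \/ exists x y, a x y <= t /\ s = b x y].
have S0 t : S t 0 by left.
have S_sup t : has_sup (S t).
  split; first by exists 0.
  have t1 : 0 < `|t| + 1 by rewrite ltr_wpDl.
  have /ab[r r0 tr] : metric_coarse a (entourage_le a (`|t| + 1)).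
    by exists (`|t| + 1).
  exists r => _ [->|[x [y [xy ->]]]]; first exact: ltW.
  apply: (tr (x, y)); rewrite /entourage_le/= (le_trans xy)//.
  by rewrite (le_trans (ler_norm t))// lerDl ler01.
have S_ub t s : S t s -> s <= sup (S t).
  by move=> Ss; apply: ub_le_sup => //; exact: (S_sup t).2.
have [h [h0 hM bh]] : exists h : R -> R,
    [/\ forall t : R, 0 <= t -> 0 <= h t,
        forall s t : R, 0 <= s -> s <= t -> h s <= h t &
        forall x y, joinM b b x y <= h (joinM a b x y)].
  apply: (@joinM_ub _ _ b b a b (fun t => sup (S t)) id) => //.
  - by move=> t _; exact: S_ub.
  - move=> s t s0 st; apply: ge_sup; first by exists 0.
    move=> _ [->|[x [y [xy ->]]]]; first exact: S_ub.
    by apply: S_ub; right; exists x, y; rewrite (le_trans xy).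
  - by move=> x y; apply: S_ub; right; exists x, y.
apply/eqP/mclassP/coarsely_equivalent_sym/coarsely_equivalentP.
exists h, id; split => // x y; last exact: join_dist_ler.
by have := bh x y; rewrite joinMM.
Qed.

Lemma bigcup_metric_coarse_principal al :
  \bigcup_(d in [set d | principal_ideal al (mclass d)]) metric_coarse d =
  class_coarse al.
Proof.
have [a ->] := mclass_surj al; rewrite class_coarseE.
apply/seteqP; split => [A [d /le_mclassP da]|A aA]; first exact: da.
by exists a => //; rewrite /principal_ideal/=.
Qed.

Lemma is_ideal_principal al : is_ideal (principal_ideal al).
Proof.
split=> [be ga bega gaal|be ga beal gaal]; first exact: le_trans gaal.
by rewrite /principal_ideal/= leUx beal.
Qed.

Lemma is_ideal_bigcup_principal (delta : nat -> metricClass R X) :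
  {homo delta : m n / (m <= n)%N >-> (m <= n)%O} ->
  is_ideal (\bigcup_n principal_ideal (delta n)).
Proof.
move=> deltaM; split=> [be ga bega [n _ gan]|be ga [m _ bem] [n _ gan]].
  by exists n => //; exact: le_trans gan.
exists (maxn m n) => //; rewrite /principal_ideal/= leUx.
by rewrite (le_trans bem) ?(le_trans gan)// deltaM ?leq_maxl ?leq_maxr.
Qed.

End CoarseOrder.

(** * The limit of a decreasing sequence of metrics *)

Section LimitMetric.
Context {R : realType} {X : Type}.
Variable d : nat -> udMetric R X.
Hypothesis d_decr : forall m n x y, (m <= n)%N -> d n x y <= d m x y.

Definition limit_dist x y : R :=
  sup (range (fun n => Num.min (d n x y) n%:R)).

(** For [n <= m] the term [m] is at most [d m <= d n], and for [m <= n] it is at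
    most its cap [m <= n]. *)
Lemma truncation_le m n x y : Num.min (d m x y) m%:R <= d n x y + n%:R.
Proof.
rewrite ge_min; have [nm|mn] := leqP n m.
  by rewrite (le_trans (d_decr _ _ x y nm))// lerDl ler0n.
by rewrite (_ : m%:R <= _) ?orbT// ler_wpDl ?dist_ge0// ler_nat ltnW.
Qed.

Lemma limit_dist_le n x y : limit_dist x y <= d n x y + n%:R.
Proof.
apply: ge_sup; first by exists (Num.min (d 0%N x y) 0%:R); exists 0%N.
by move=> _ [m _ <-]; exact: truncation_le.
Qed.

Lemma truncation_le_limit n x y : Num.min (d n x y) n%:R <= limit_dist x y.
Proof.
apply: ub_le_sup; last by exists n.
by exists (d 0%N x y + 0%:R) => _ [m _ <-]; exact: truncation_le.
Qed.

Lemma limit_dist_ge0 x y : 0 <= limit_dist x y.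
Proof. by rewrite (le_trans _ (truncation_le_limit 0 x y))// le_min dist_ge0 lexx. Qed.

Lemma limit_dist_discrete :
  exists2 r : R, 0 < r & forall x y, x <> y -> r <= limit_dist x y.
Proof.
have [r r0 rd] := dist_discrete (d 1%N).
exists (Num.min r 1) => [|x y xy]; first by rewrite lt_min r0 ltr01.
rewrite (le_trans _ (truncation_le_limit 1 x y))// le_min !ge_min rd//=.
by rewrite lexx orbT.
Qed.

Lemma limit_dist_eq0 x y : limit_dist x y = 0 <-> x = y.
Proof.
split=> [l0|->].
  have [r r0 rl] := limit_dist_discrete.
  by apply: contrapT => /rl; rewrite l0 leNgt r0.
apply/eqP; rewrite eq_le limit_dist_ge0 andbT.
by rewrite (le_trans (limit_dist_le 0 y y))// dist_xx addr0.
Qed.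

Lemma limit_distC x y : limit_dist x y = limit_dist y x.
Proof. by rewrite /limit_dist; under eq_fun do rewrite distC. Qed.

Lemma limit_dist_triangle x y z :
  limit_dist x z <= limit_dist x y + limit_dist y z.
Proof.
apply: ge_sup; first by exists (Num.min (d 0%N x z) 0%:R); exists 0%N.
move=> _ [n _ <-].
apply: le_trans (lerD (truncation_le_limit n x y) (truncation_le_limit n y z)).
have := dist_triangle (d n) x y z.
have dxy := dist_ge0 (d n) x y; have dyz := dist_ge0 (d n) y z.
have n0 : 0 <= n%:R :> R by exact: ler0n.
rewrite ge_min; case: (leP (d n x y) n%:R) => xyn; last first.
  by rewrite (_ : n%:R <= _) ?orbT// lerDl le_min dyz.
case: (leP (d n y z) n%:R) => yzn; first by move=> ->.
by rewrite (_ : n%:R <= _) ?orbT// lerDr.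
Qed.

Definition limitM : udMetric R X :=
  UdMetric limit_dist_ge0 limit_dist_eq0 limit_distC
           limit_dist_triangle limit_dist_discrete.

(** An index [n] beyond the radius makes the cap of the [n]-th term inactive. *)
Lemma metric_coarse_limitM :
  metric_coarse limitM = \bigcup_n metric_coarse (d n).
Proof.
apply/seteqP; split=> [A [r r0 Ar]|A [n _ [r r0 Ar]]].
  pose n := (Num.truncn r).+1; have rn : r < n%:R by exact: truncnS_gt.
  exists n => //; exists r => // p /Ar; rewrite /entourage_le/= => lr.
  have := le_trans (truncation_le_limit n p.1 p.2) lr.
  by rewrite ge_min [n%:R <= r]leNgt rn orbF.
exists (r + n%:R); first by rewrite ltr_wpDr ?ler0n.
move=> p /Ar pr; rewrite /entourage_le/=.
by rewrite (le_trans (limit_dist_le n _ _))// lerD2r.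
Qed.

End LimitMetric.

(** * Increasing sequences of classes *)

Section IncreasingClasses.
Context {R : realType} {X : Type}.
Variable delta : nat -> metricClass R X.
Hypothesis delta_homo : {homo delta : m n / (m <= n)%N >-> (m <= n)%O}.

Fixpoint decreasing_repr n : udMetric R X :=
  if n is m.+1 then joinM (decreasing_repr m) (repr (delta m.+1))
  else repr (delta 0%N).

Lemma mclass_decreasing_repr n : mclass (decreasing_repr n) = delta n.
Proof.
elim: n => [|n IHn] /=; first by rewrite /mclass generic_quotient.reprK.
rewrite -join_classE IHn /mclass generic_quotient.reprK.
by apply/eqP; exact: (delta_homo _ _ (leqnSn n)).
Qed.

Lemma decreasing_repr_le m n x y :
  (m <= n)%N -> decreasing_repr n x y <= decreasing_repr m x y.
Proof.
elim: n => [|n IHn]; first by rewrite leqn0 => /eqP->.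
rewrite leq_eqVlt ltnS => /predU1P[->//|/IHn]; apply: le_trans.
exact: join_dist_lel.
Qed.

Lemma bigcup_class_coarse_metrizable :
  exists d : udMetric R X, \bigcup_n class_coarse (delta n) = metric_coarse d.
Proof.
exists (limitM _ decreasing_repr_le); rewrite metric_coarse_limitM.
by apply: eq_bigcupr => n _; rewrite -mclass_decreasing_repr class_coarseE.
Qed.

End IncreasingClasses.

Theorem lemma4p4 (R : realType) (X : Type) (delta : nat -> metricClass R X)
    (delta_incr : forall n : nat, (delta n < delta n.+1)%O) :
  let EE : set (set (X * X)) := \bigcup_(n : nat) class_coarse (delta n) in
  let F1 : set (metricClass R X) :=
    [set mclass d | d in [set d : udMetric R X | dominated d EE]] in
  let F2 : set (metricClass R X) :=
    \bigcup_(n : nat) principal_ideal (delta n) in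
  [/\ EE = coarse_generated (\bigcup_(n : nat) class_coarse (delta n)),
      is_ideal F1,
      is_ideal F2,
      F1 <> F2 &
      ideal_coarse F1 = ideal_coarse F2].
Proof.
have deltaM : {homo delta : m n / (m <= n)%N >-> (m <= n)%O}.
  by apply: homo_leq => [//|? ? ?|n]; [exact: le_trans | exact: ltW].
move=> EE F1 F2; have [l EEl] := bigcup_class_coarse_metrizable _ deltaM.
have F1l : F1 = principal_ideal (mclass l).
  apply/seteqP; split=> [_ [a /= aEE <-]|al].
    by apply/le_mclassP/dominated_metric_coarse; rewrite -EEl.
  have [a ->] := mclass_surj al => /le_mclassP al_le.
  by exists a => //=; rewrite /EE EEl; exact/dominated_metric_coarse.
split.
- by apply/esym/smallest_id; rewrite EEl; exact: is_coarse_metric_coarse.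
- by rewrite F1l; exact: is_ideal_principal.
- exact: is_ideal_bigcup_principal.
- move=> F12; have [n _ ln] : F2 (mclass l).
    by rewrite -F12 F1l /principal_ideal/=.
  have : (delta n.+1 <= mclass l)%O.
    have [a aE] := mclass_surj (delta n.+1); rewrite aE.
    apply/le_mclassP; rewrite -EEl -class_coarseE -aE.
    by move=> A An; exists n.+1.
  by move=> /le_trans /(_ ln); rewrite lt_geF.
- rewrite /ideal_coarse F1l bigcup_metric_coarse_principal class_coarseE -EEl.
  congr coarse_generated; apply/seteqP; split=> [A [n _]|A [d [n _ dn] dA]].
    rewrite -bigcup_metric_coarse_principal => -[d dn dA].
    by exists d => //; exists n.
  exists n => //; rewrite -bigcup_metric_coarse_principal.
  by exists d.
Qed.
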